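(* Let $k \geq 3$ and let $G$ be the graph on $n = k+1$ vertices obtained from the cycle $C_k$ by adding one new vertex $u$ and one edge joining $u$ to a vertex of the cycle. Then $\gamma_{gr}^L(G) = n$.
   Context: For a vertex $v$, $N(v)$ is its open neighborhood (the set of its neighbors) and $N[v] = N(v) \cup \{v\}$ its closed neighborhood. An L-sequence of a graph $G$ is a sequence $(v_1, \ldots, v_k)$ of distinct vertices of $G$ such that for every $i \in \{1,\ldots,k\}$, $N[v_i] \setminus \bigcup_{j=1}^{i-1} N(v_j) \neq \emptyset$. The L-Grundy domination number $\gamma_{gr}^L(G)$ is the maximum length of an L-sequence of $G$. *)

(* Defs.v *)
From mathcomp Require Import all_boot.

Set Implicit Arguments.
Unset Strict Implicit.
Unset Printing Implicit Defensive.

Record sgraph := SGraph {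
  vertex :> finType;
  adj : rel vertex;
  adj_sym : symmetric adj;
  adj_irrefl : irreflexive adj }.

Section Domination.
Variable G : sgraph.

Definition open_nbh (v : G) : {set G} := [set w | adj v w].

Definition closed_nbh (v : G) : {set G} := v |: open_nbh v.

Definition L_sequence (m : nat) (s : m.-tuple G) : bool :=
  uniq s &&
  [forall i : 'I_m, closed_nbh (tnth s i)
     :\: \bigcup_(j < m | j < i) open_nbh (tnth s j) != set0].

(* Vertices of an L-sequence are distinct, so lengths beyond #|G| cannot
   occur; see L_grundy_max. *)
Definition L_grundy : nat :=
  \max_(m < #|G|.+1 | [exists s : m.-tuple G, L_sequence s]) m.

Lemma L_grundy_max m (s : m.-tuple G) : L_sequence s -> m <= L_grundy.
Proof.
move=> Ls; have lt_m : m < #|G|.+1.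
  have /andP[/card_uniqP card_s _] := Ls.
  by rewrite ltnS -[X in X <= _](size_tuple s) -card_s max_card.
by apply: (bigmax_sup (Ordinal lt_m)) => //; apply/existsP; exists s.
Qed.

Lemma L_grundy_attained : exists s : L_grundy.-tuple G, L_sequence s.
Proof.
apply: (big_ind (fun m => exists s : m.-tuple G, L_sequence s))
  => [|m1 m2 ex1 ex2|m /existsP //].
  by exists [tuple]; apply/andP; split=> //; apply/forallP; case.
by case/orP: (leq_total m1 m2) => [/maxn_idPr|/maxn_idPl] ->.
Qed.

End Domination.

Section Cycle.
Variables (k : nat) (k_ge3 : 3 <= k).

Definition cycle_adj : rel 'I_k := fun i j => (j == ordS i) || (i == ordS j).

Lemma cycle_adj_sym : symmetric cycle_adj.
Proof. by move=> i j; rewrite /cycle_adj orbC. Qed.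

Lemma cycle_adj_irrefl : irreflexive cycle_adj.
Proof.
move=> i; rewrite /cycle_adj orbb -val_eqE /=; apply/negbTE.
have := ltn_ord i; rewrite leq_eqVlt => /orP[/eqP ik|ik].
  by rewrite ik modnn -lt0n -ltnS ik ltnW.
by rewrite modn_small // neq_ltn ltnSn.
Qed.

Definition cycle_graph : sgraph := SGraph cycle_adj_sym cycle_adj_irrefl.

End Cycle.

Section Pendant.
Variables (G : sgraph) (v : G).

(* None is the new vertex, adjacent to Some v only. *)
Definition pendant_adj : rel (option G) := fun x y =>
  match x, y with
  | Some a, Some b => adj a b
  | Some a, None | None, Some a => a == v
  | None, None => false
  end.

Lemma pendant_adj_sym : symmetric pendant_adj.
Proof. by case=> [a|] [b|] //=; apply: adj_sym. Qed.

Lemma pendant_adj_irrefl : irreflexive pendant_adj.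
Proof. by case=> [a|] //=; apply: adj_irrefl. Qed.

Definition add_pendant : sgraph := SGraph pendant_adj_sym pendant_adj_irrefl.

Lemma card_add_pendant : #|add_pendant| = #|G|.+1.
Proof. exact: card_option. Qed.

End Pendant.

(* Main.v *)
Require Import Defs.
From mathcomp Require Import all_boot.
From mathcomp Require Import zify.

(** Number the cycle c_0, ..., c_(k-1), with the pendant vertex u attached to
    c_0.  The order "u, the vertices of odd index, the vertices of even index
    in decreasing order" is an L-sequence through all vertices: u and c_0
    footprint u, a vertex of odd index footprints itself (all its neighbors
    have even index), and c_j with j > 0 even footprints c_(j-1), whose other
    neighbor c_(j-2) comes later. *)

Lemma L_grundy_le_card (G : sgraph) : L_grundy G <= #|G|.
Proof. by apply/bigmax_leqP => m _; rewrite -ltnS. Qed.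

(* The L-sequence lists the vertices by decreasing rank, and [f x] is a vertex
   footprinted by [x]. *)
Lemma L_grundy_eq_card (G : sgraph) (r : G -> nat) (f : G -> G) :
    injective r -> (forall x, f x \in closed_nbh x) ->
    (forall x y, adj y (f x) -> r y <= r x) ->
  L_grundy G = #|G|.
Proof.
move=> r_inj f_nbh f_adj; apply/eqP; rewrite eqn_leq L_grundy_le_card /=.
pose e : rel G := relpre r geq; pose s := sort e (enum G).
have e_total : total e by move=> x y; apply: leq_total.
have e_trans : transitive e by move=> y x z /= le_yx le_zy; apply: leq_trans le_yx.
have size_s : size s == #|G| by rewrite size_sort -cardE.
have s_uniq : uniq s by rewrite sort_uniq enum_uniq.
apply: (@L_grundy_max G #|G| (Tuple size_s)).
rewrite /L_sequence s_uniq; apply/forallP => i.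
apply/set0Pn; exists (f (tnth (Tuple size_s) i)); rewrite inE f_nbh andbT.
apply/bigcupP => -[j lt_ji]; rewrite inE => /f_adj.
pose x0 := tnth (Tuple size_s) i.
rewrite !(tnth_nth x0) /= => le_r.
have lt_size (l : 'I_#|G|) : l < size s by rewrite (eqP size_s).
have le_r' : e (nth x0 s j) (nth x0 s i).
  apply: (sorted_ltn_nth e_trans) => //; first exact: sort_sorted.
  - exact: lt_size.
  - exact: lt_size.
(* An earlier neighbor of the footprinted vertex has rank at most that of entry [i] by [f_adj] and
   at least that by sorting; equal ranks contradict distinctness. *)
have /r_inj/eqP : r (nth x0 s j) = r (nth x0 s i).
  by apply/eqP; rewrite eqn_leq le_r; apply: le_r'.
by rewrite nth_uniq ?lt_size // => /eqP eq_ji; rewrite eq_ji ltnn in lt_ji.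
Qed.

Lemma val_ordS {k : nat} (i : 'I_k) :
  ordS i = (if i.+1 == k then 0 else i.+1) :> nat.
Proof.
rewrite /=; case: eqP => [->|ne_ik]; first exact: modnn.
by rewrite modn_small //; have := ltn_ord i; lia.
Qed.

(* The index of [i] on the cycle counted from [v], that is, i - v modulo k. *)
Definition cycle_dist {k : nat} (v i : 'I_k) : nat :=
  if v <= i then i - v else i + k - v.

Section CycleDist.
Variables (k : nat) (v : 'I_k).

Lemma cycle_dist_lt i : cycle_dist v i < k.
Proof. by rewrite /cycle_dist; move: (ltn_ord i) (ltn_ord v); case: ifP; lia. Qed.

Lemma cycle_dist_inj : injective (cycle_dist v).
Proof.
move=> i j; rewrite /cycle_dist => eq_ij; apply: val_inj => /=.
by move: eq_ij (ltn_ord i) (ltn_ord j) (ltn_ord v); repeat case: ifP; lia.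
Qed.

Lemma cycle_dist_eq0 i : (cycle_dist v i == 0) = (i == v).
Proof.
rewrite -val_eqE /cycle_dist /=; move: (ltn_ord i) (ltn_ord v).
by case: ifP; lia.
Qed.

Lemma cycle_dist_ordS i : cycle_dist v (ordS i) =
  if (cycle_dist v i).+1 == k then 0 else (cycle_dist v i).+1.
Proof.
rewrite /cycle_dist val_ordS; move: (ltn_ord i) (ltn_ord v).
by repeat case: ifP; lia.
Qed.

Lemma cycle_dist_ord_pred i : 0 < cycle_dist v i ->
  cycle_dist v (ord_pred i) = (cycle_dist v i).-1.
Proof.
move=> i_gt0; have := cycle_dist_ordS (ord_pred i); rewrite ord_predK.
by case: eqP; lia.
Qed.

End CycleDist.

Theorem theorem3p6 (k : nat) (k_ge3 : 3 <= k) (v : cycle_graph k_ge3) :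
  L_grundy (add_pendant v) = k.+1.
Proof.
rewrite -[in RHS](card_ord k) -(card_add_pendant v).
pose d : 'I_k -> nat := cycle_dist v.
have d_lt i : d i < k by apply: cycle_dist_lt.
have d0 (i : 'I_k) : (i == v) = (d i == 0) by rewrite -cycle_dist_eq0.
(* Even indices keep ranks below [k], the shift by [k] puts odd ones strictly between [k] and
   [k + k], and u is on top. *)
pose r (x : add_pendant v) :=
  if x is Some i then if odd (d i) then k + d i else d i else k + k.
pose f (x : add_pendant v) : add_pendant v :=
  if x is Some i then
    if odd (d i) then Some i else if d i == 0 then None else Some (ord_pred i)
  else None.
apply: (@L_grundy_eq_card _ r f).
- move=> [i|] [j|] //=; last first.
  + by have := d_lt j; case: ifP; lia.
  + by have := d_lt i; case: ifP; lia.
  move=> eq_r; congr Some; apply: (@cycle_dist_inj _ v); rewrite -!/(d _).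
  by move: eq_r (d_lt i) (d_lt j); repeat case: ifP; lia.
- move=> [i|]; rewrite /f; last by rewrite setU11.
  case: ifP => [_|_]; first by rewrite setU11.
  case: ifP => [d_eq0|_]; rewrite !inE /=; first by rewrite d0.
  by rewrite /cycle_adj ord_predK eqxx !orbT.
(* Adjacency becomes arithmetic on indices, including the wrap-around from c_(k-1) to c_0. *)
have adjP (i j : 'I_k) : cycle_adj i j ->
    d j = (if (d i).+1 == k then 0 else (d i).+1) \/
    d i = (if (d j).+1 == k then 0 else (d j).+1).
  by case/orP => /eqP ->; [left | right]; apply: cycle_dist_ordS.
move=> [i|] [j|] //=; last 2 first.
(* u is first in the order, so it must not be adjacent to the vertex footprinted by a cycle vertex:
   that vertex is u itself or has odd index, hence is not c_0. *)
- case: ifP => [odd_i | even_i]; first by rewrite d0; case: eqP odd_i => // ->.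
  case: eqP => //= ne_i; rewrite d0 /d cycle_dist_ord_pred -/(d i); lia.
- by case: ifP; have := d_lt j; lia.
case: ifP => odd_i.
  by move/adjP; move: (d_lt i) (d_lt j); repeat case: ifP; lia.
case: ifP => [d_eq0 | d_neq0]; first by rewrite d0 => /eqP ->.
(* Here [d i] is at least 2, so the neighbors of c_(d i - 1) on the cycle are c_(d i) and c_(d i -
   2), without wrap-around. For odd [k] the adjacent even indices 0 and [k - 1] thus do no harm. *)
have pred_i : d (ord_pred i) = (d i).-1.
  by apply: cycle_dist_ord_pred; rewrite lt0n -/(d i) d_neq0.
move/adjP; rewrite pred_i; move: (d_lt i) (d_lt j).
by repeat case: ifP; lia.
Qed.
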